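(* For all positive integers $n,k$ and every probability distribution $P=(p_1,\dots,p_k)$ on $\{1,\dots,k\}$, it holds that $\|2nV_{n,k,P}\|_{\psi_1}\leq 4(k-1)$ and $\|2nV_{n,k,P}-\mathbb{E}[2nV_{n,k,P}]\|_{\psi_1}\leq 8(k-1)$. In particular, there exist universal constants $C_1,C_2>0$ such that for all $n$, $k$, $P$ and all real $m\geq 1$, \[ \mathbb{E}\big[(2nV_{n,k,P})^m\big]\leq (C_1m(k-1))^m,\qquad \mathbb{E}\big[(2nV_{n,k,P}-\mathbb{E}[2nV_{n,k,P}])^m\big]\leq (C_2m(k-1))^m. \]
   Context: $X=(X_1,\dots,X_k)$ is multinomially distributed with $n$ samples and probabilities $P$, and $V_{n,k,P}=D\big((X_1/n,\dots,X_k/n)\,\|\,(p_1,\dots,p_k)\big)$ where $D\big((q_i)_i\,\|\,(p_i)_i\big)=\sum_i q_i\log\frac{q_i}{p_i}$ is the Kullback--Leibler divergence (natural logarithm, convention $0\log(0/p)=0$). For a real random variable $Y$, the subexponential norm is $\|Y\|_{\psi_1}=\inf\{t>0:\mathbb{E}[\exp(|Y|/t)]\leq 2\}$. *)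

(* Defs.v *)
From mathcomp Require Import all_boot all_order all_algebra.
From mathcomp Require Import all_classical all_reals all_analysis.
Unset Implicit Arguments.
Unset Strict Implicit.
Unset Printing Implicit Defensive.
Import Order.TTheory GRing.Theory Num.Theory.
Local Open Scope ring_scope.
Local Open Scope classical_set_scope.

Definition mn_support (n k : nat) (x : {ffun 'I_k -> 'I_n.+1}) : bool :=
  (\sum_(i < k) (x i : nat) == n)%N.

Definition mn_pmf {R : realType} (n k : nat) (P : 'I_k -> R)
  (x : {ffun 'I_k -> 'I_n.+1}) : R :=
  ((n`!)%:R / \prod_(i < k) (((x i : nat)`!)%:R)) * \prod_(i < k) P i ^+ (x i : nat).

Definition mn_expect {R : realType} (n k : nat) (P : 'I_k -> R)
  (f : {ffun 'I_k -> 'I_n.+1} -> R) : R :=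
  \sum_(x : {ffun 'I_k -> 'I_n.+1} | mn_support n k x) mn_pmf n k P x * f x.

Definition KL {R : realType} (k : nat) (q p : 'I_k -> R) : R :=
  \sum_(i < k) (if q i == 0 then 0 else q i * ln (q i / p i)).

Definition V_stat {R : realType} (n k : nat) (P : 'I_k -> R)
  (x : {ffun 'I_k -> 'I_n.+1}) : R :=
  KL k (fun i => (x i : nat)%:R / n%:R) P.

Definition psi1_norm {R : realType} (n k : nat) (P : 'I_k -> R)
  (Y : {ffun 'I_k -> 'I_n.+1} -> R) : R :=
  inf [set t : R | 0 < t /\ mn_expect n k P (fun x => expR (`|Y x| / t)) <= 2].

Definition is_distribution {R : realType} (k : nat) (P : 'I_k -> R) : Prop :=
  (forall i, 0 <= P i) /\ \sum_(i < k) P i = 1.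

(* Main.v *)
Require Import Defs.
From mathcomp Require Import all_boot all_order all_algebra.
From mathcomp Require Import all_classical all_reals all_analysis.
From mathcomp Require Import ring lra zify.
Import Order.TTheory GRing.Theory Num.Theory.
Local Open Scope ring_scope.

(** The key estimate is E[exp(s n V)] <= (1 - s)^-(k-1) for 0 <= s < 1. On the
    outcome x, the likelihood times exp(s n V) is n!/prod_i x_i! times the product
    of ((x_i/n)^s p_i^(1-s))^x_i. For two cells, weighted AM-GM replaces the bases
    by s x/n + (1-s) p and its complement to 1, and the Abel-Jensen identity
    evaluates the resulting sum as sum_j n(n-1)...(n-j+1) (s/n)^j <= sum_j s^j,
    uniformly in p; further cells are split off one at a time. At s = 1/(2(k-1))
    Bernoulli's inequality bounds (1 - s)^-(k-1) by 2. Centering costs a factor 2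
    by the inequalities of Jensen and Cauchy-Schwarz, and the moments follow
    from u^m <= m^m exp(u - m). *)

(** * Finite differences and the Abel-Jensen identity *)

(** An [m]-th finite difference kills degrees below [m] and multiplies the coefficient of degree [m]
    by [m!]. The induction peels off one factor [a + b * x]; absorbing its [x] into the binomial
    lowers [m] and shifts [a] to [a + b]. *)
Lemma alternating_sum_powers (A : comNzRingType) (e m : nat) (a b : A) : (e <= m)%N ->
  \sum_(x < m.+1) 'C(m, x)%:R * (-1) ^+ (m - x) * (a + b * x%:R) ^+ e
  = if e == m then m`!%:R * b ^+ m else 0.
Proof.
elim: e m a => [|e IHe] m a le_em.
  have -> : \sum_(x < m.+1) 'C(m, x)%:R * (-1) ^+ (m - x) * (a + b * x%:R) ^+ 0
            = (-1 + 1) ^+ m :> A.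
    rewrite exprDn; apply: eq_bigr => x _.
    by rewrite expr0 expr1n !mulr1 mulr_natl.
  by rewrite addNr expr0n eq_sym; case: m le_em => //= _; rewrite fact0 mulr1.
case: m le_em => // m; rewrite ltnS eqSS => le_em.
have {1}-> : \sum_(x < m.+2)
    'C(m.+1, x)%:R * (-1) ^+ (m.+1 - x) * (a + b * x%:R) ^+ e.+1
  = a * (\sum_(x < m.+2) 'C(m.+1, x)%:R * (-1) ^+ (m.+1 - x) * (a + b * x%:R) ^+ e)
  + m.+1%:R * b *
    (\sum_(x < m.+1) 'C(m, x)%:R * (-1) ^+ (m - x) * (a + b + b * x%:R) ^+ e).
  transitivity (\sum_(x < m.+2) (a * ('C(m.+1, x)%:R * (-1) ^+ (m.+1 - x) *
      (a + b * x%:R) ^+ e) + (x * 'C(m.+1, x))%N%:R * b *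
      ((-1) ^+ (m.+1 - x) * (a + b * x%:R) ^+ e))).
    by apply: eq_bigr => x _; rewrite exprS natrM; ring.
  rewrite big_split /= -mulr_sumr; congr (_ + _).
  rewrite big_ord_recl mul0n !mul0r add0r mulr_sumr; apply: eq_bigr => x _.
  rewrite lift0 -mul_bin_diag natrM subSS -[x.+1]addn1 natrD.
  have -> : a + b * (x%:R + 1) = a + b + b * x%:R by ring.
  by ring.
rewrite !IHe //; last exact: leqW.
rewrite (ltn_eqF (leq_ltn_trans le_em (ltnSn m))) mulr0 add0r.
by case: eqP => // _; rewrite ?mulr0 // factS natrM exprS; ring.
Qed.

Lemma bin_mul_bin (n x i : nat) : (x <= n)%N -> (i <= n - x)%N ->
  ('C(n, x + i) * 'C(x + i, x) = 'C(n, x) * 'C(n - x, i))%N.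
Proof.
move=> le_xn le_i; have le_xin : (x + i <= n)%N by lia.
have e1 := bin_fact le_xn; have e2 := bin_fact le_i.
have e3 := bin_fact le_xin; have e4 := bin_fact (leq_addr i x).
rewrite addKn in e4; rewrite subnDA in e3; rewrite -e2 in e1; rewrite -e4 in e3.
have pos : (0 < x`! * i`! * (n - x - i)`!)%N by rewrite !muln_gt0 !fact_gt0.
apply/eqP; rewrite -(eqn_pmul2r pos); apply/eqP; move: e1 e3; nia.
Qed.

(* Expanding the second power in [s] turns the coefficient of [s ^+ (n - i)] into
   an [i]-th finite difference of a polynomial of degree [i]. *)
Lemma abel_jensen_identity (A : comNzRingType) (n : nat) (a b s : A) :
  \sum_(x < n.+1) 'C(n, x)%:R * (a + b * x%:R) ^+ x * (s - (a + b * x%:R)) ^+ (n - x)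
  = \sum_(j < n.+1) (n ^_ j)%:R * b ^+ j * s ^+ (n - j).
Proof.
(* Padding the triangle [x <= i] with zeros to a square lets the sums be exchanged. *)
transitivity (\sum_(x < n.+1) \sum_(i < n.+1)
   (if (x <= i)%N then ('C(n, i) * 'C(i, x))%N%:R * s ^+ (n - i) * (-1) ^+ (i - x)
      * (a + b * x%:R) ^+ i else 0)).
  apply: eq_bigr => x _.
  have le_xn : (x <= n)%N by rewrite -ltnS.
  rewrite -(big_mkord xpredT (fun i => if (x <= i)%N then
    ('C(n, i) * 'C(i, x))%N%:R * s ^+ (n - i) * (-1) ^+ (i - x) * (a + b * x%:R) ^+ i
    else 0)).
  rewrite (big_cat_nat (n := x)) //=; last exact: leqW.
  rewrite big_nat_cond big1 ?add0r; last first.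
    by move=> i /andP[/andP[_ lt_ix] _]; rewrite leqNgt lt_ix.
  have -> : index_iota x n.+1 = index_iota (0 + x) n.+1 by [].
  rewrite big_addn subSn // big_mkord.
  rewrite [(s - _) ^+ _]exprDn mulr_sumr; apply: eq_bigr => i _.
  have le_i : (i <= n - x)%N by rewrite -ltnS.
  rewrite leq_addl addnK (exprNn (a + _)) [(i + x)%N]addnC subnDA exprD.
  have -> : ('C(n, x + i) * 'C(x + i, x) = 'C(n, x) * 'C(n - x, i))%N.
    exact: bin_mul_bin.
  by rewrite natrM -mulr_natr; ring.
rewrite exchange_big /=; apply: eq_bigr => i _.
have le_in : (i <= n)%N by rewrite -ltnS.
transitivity ('C(n, i)%:R * s ^+ (n - i) *
  \sum_(x < i.+1) 'C(i, x)%:R * (-1) ^+ (i - x) * (a + b * x%:R) ^+ i).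
  rewrite -big_mkcond /= mulr_sumr (big_ord_widen_cond n.+1 xpredT
    (fun x => 'C(n, i)%:R * s ^+ (n - i) *
      ('C(i, x)%:R * (-1) ^+ (i - x) * (a + b * x%:R) ^+ i))) //.
  by apply: eq_bigr => x _; rewrite natrM; ring.
by rewrite alternating_sum_powers // eqxx -bin_ffact natrM; ring.
Qed.

(** * The tilted binomial sum for two cells *)

(** Young's inequality with conjugate exponents [s^-1] and [(1 - s)^-1], which requires [s] to be
    positive. *)
Lemma weighted_AMGM (R : realType) (s u v : R) : 0 <= s < 1 -> 0 <= u -> 0 <= v ->
  u `^ s * v `^ (1 - s) <= s * u + (1 - s) * v.
Proof.
move=> /andP[s0 s1] u0 v0; have [->|sN0] := eqVneq s 0.
  by rewrite powRr0 subr0 powRr1 // mul0r add0r.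
have s_gt0 : 0 < s by rewrite lt0r sN0.
have t_gt0 : 0 < 1 - s by rewrite subr_gt0.
have := @conjugate_powR R (u `^ s) (v `^ (1 - s)) s^-1 (1 - s)^-1 (powR_ge0 _ _)
  (powR_ge0 _ _).
rewrite !invr_gt0 !invrK -!powRrM !divff ?gt_eqF // !powRr1 // ![_ * s]mulrC.
by rewrite [v * _]mulrC; apply => //; rewrite addrC subrK.
Qed.

Lemma sum_geometric_le (R : realType) (s : R) (n : nat) : 0 <= s < 1 ->
  \sum_(j < n) s ^+ j <= (1 - s)^-1.
Proof.
move=> /andP[s0 s1]; have t_gt0 : 0 < 1 - s by rewrite subr_gt0.
rewrite -(ler_pM2l t_gt0) divff ?gt_eqF // -opprB mulNr -subrX1 opprB.
by rewrite gerBl exprn_ge0.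
Qed.

Lemma ffact_le_expn (n j : nat) : (n ^_ j <= n ^ j)%N.
Proof.
elim: j n => [|j IHj] n; first by rewrite ffactn0.
case: n => [|n]; first by rewrite ffact0n.
rewrite ffactSS expnS leq_mul2l /= (leq_trans (IHj n)) //.
by case: (j) => // i; rewrite leq_exp2r.
Qed.

Lemma binomial_tilt_le (R : realType) (n : nat) (s p q : R) :
  0 <= s < 1 -> 0 <= p -> 0 <= q ->
  \sum_(j < n.+1) 'C(n, j)%:R * (j%:R `^ s * p `^ (1 - s)) ^+ j *
     ((n - j)%:R `^ s * q `^ (1 - s)) ^+ (n - j)
  <= (1 - s)^-1 * (n%:R `^ s * (p + q) `^ (1 - s)) ^+ n.
Proof.
move=> s01 p0 q0; have [s0 s1] := andP s01.
have t_gt0 : 0 < 1 - s by rewrite subr_gt0.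
case: n => [|n].
  by rewrite big_ord1 bin0 !mul1r !expr0 mulr1 invf_ge1 // gerBl.
have [pq0|pq_neq0] := eqVneq (p + q) 0.
  have [-> ->] : p = 0 /\ q = 0 by split; lra.
  (* Every term vanishes, because [j] or [n.+1 - j] is positive and [0] to the nonzero power [1 - s]
     is [0]. *)
  rewrite addr0 powR0 ?gt_eqF // mulr0 expr0n mulr0 big1 // => j _.
  case: (nat_of_ord j) => [|i]; first by rewrite !mulr0 expr0 subn0 expr0n mulr0.
  by rewrite !mulr0 expr0n mulr0 mul0r.
have pq_gt0 : 0 < p + q by rewrite lt0r pq_neq0 addr_ge0.
have N_gt0 : 0 < n.+1%:R :> R by rewrite ltr0n.
set M := n.+1%:R `^ s * (p + q) `^ (1 - s).
have M0 : 0 <= M by rewrite mulr_ge0 ?powR_ge0.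
have amgm (i : nat) (r : R) : 0 <= r -> i%:R `^ s * r `^ (1 - s) <=
    M * (s * (i%:R / n.+1%:R) + (1 - s) * (r / (p + q))).
  move=> r0; have -> : i%:R `^ s * r `^ (1 - s) =
      M * ((i%:R / n.+1%:R) `^ s * (r / (p + q)) `^ (1 - s)).
    rewrite /M mulrACA -!powRM ?divr_ge0 ?ler0n // ?ltW //.
    by rewrite ![_ * (_ / _)]mulrC !divfK ?gt_eqF.
  by rewrite ler_wpM2l // weighted_AMGM // divr_ge0 // ltW.
(* Only [a] involves [p] and [q], while the Abel-Jensen sum depends on [b] alone: hence the
   uniformity. *)
pose a := (1 - s) * (p / (p + q)); pose b := s / n.+1%:R.
apply: (@le_trans _ _ (M ^+ n.+1 * \sum_(j < n.+2) 'C(n.+1, j)%:R *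
    (a + b * j%:R) ^+ j * (1 - (a + b * j%:R)) ^+ (n.+1 - j))).
  rewrite mulr_sumr; apply: ler_sum => j _.
  have le_jn : (j <= n.+1)%N by rewrite -ltnS.
  rewrite -[X in M ^+ X](subnKC le_jn) exprD.
  have -> : 1 - (a + b * j%:R) =
      s * ((n.+1 - j)%:R / n.+1%:R) + (1 - s) * (q / (p + q)).
    by rewrite /a /b natrB //; field; rewrite pq_neq0 nat1r gt_eqF.
  have -> : a + b * j%:R = s * (j%:R / n.+1%:R) + (1 - s) * (p / (p + q)).
    by rewrite /a /b addrC; congr (_ + _); rewrite mulrAC mulrA.
  set x := (X in _ <= _ * (_ * X ^+ _ * _)); set y := (X in _ <= _ * (_ * X ^+ _)).
  have -> : M ^+ j * M ^+ (n.+1 - j) * ('C(n.+1, j)%:R * x ^+ j * y ^+ (n.+1 - j)) =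
      'C(n.+1, j)%:R * (M * x) ^+ j * (M * y) ^+ (n.+1 - j).
    by rewrite !exprMn; ring.
  rewrite ler_pM ?mulr_ge0 ?exprn_ge0 ?mulr_ge0 ?powR_ge0 //.
    rewrite ler_wpM2l // lerXn2r ?nnegrE ?amgm //.
      by rewrite mulr_ge0 ?powR_ge0.
    by rewrite (le_trans _ (amgm _ _ p0)) // mulr_ge0 ?powR_ge0.
  rewrite lerXn2r ?nnegrE ?amgm //; first by rewrite mulr_ge0 ?powR_ge0.
  by rewrite (le_trans _ (amgm _ _ q0)) // mulr_ge0 ?powR_ge0.
rewrite mulrC ler_wpM2r ?exprn_ge0 // abel_jensen_identity.
apply: le_trans (sum_geometric_le R s n.+2 s01).
apply: ler_sum => j _; rewrite expr1n mulr1 expr_div_n mulrCA.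
rewrite ler_piMr ?exprn_ge0 // ler_pdivrMr ?exprn_gt0 // mul1r -natrX ler_nat.
exact: ffact_le_expn.
Qed.

(** * Generating functions and the exponential moments of [V_stat] *)

(* Up to the factor [n!], the coefficient of ['X^n] in a product of exponential
   generating functions; the truncation order [N] is irrelevant when [n <= N]. *)
Definition egf_coef {R : realType} (N k : nat) (w : 'I_k -> nat -> R) (n : nat) : R :=
  n`!%:R * (\prod_(i < k) \poly_(j < N.+1) (w i j / j`!%:R))`_n.

Lemma egf_coef1 (R : realType) (N n : nat) (w : 'I_1 -> nat -> R) : (n <= N)%N ->
  egf_coef N 1 w n = w ord0 n.
Proof.
move=> le_nN; rewrite /egf_coef big_ord1 coef_poly ltnS le_nN mulrC divfK //.
Qed.

(** The Cauchy product becomes a binomial convolution. Keeping [N] apart from [n] lets inductions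
    pass to [n - j] with the same polynomials. *)
Lemma egf_coefS (R : realType) (N k n : nat) (w : 'I_k.+1 -> nat -> R) : (n <= N)%N ->
  egf_coef N k.+1 w n =
  \sum_(j < n.+1) 'C(n, j)%:R * w ord0 j * egf_coef N k (fun i => w (lift ord0 i)) (n - j).
Proof.
move=> le_nN; rewrite /egf_coef big_ord_recl coefM mulr_sumr; apply: eq_bigr => j _.
have le_jn : (j <= n)%N by rewrite -ltnS.
rewrite coef_poly ltnS (leq_trans le_jn le_nN) -(bin_fact le_jn) !natrM.
by field; rewrite pnatr_eq0 -lt0n fact_gt0.
Qed.

(** Expanding the product picks an exponent [x i] in each factor; extracting the coefficient of
    degree [n] enforces [mn_support]. *)
Lemma sum_egf (R : realType) (n k : nat) (w : 'I_k -> nat -> R) :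
  \sum_(x : {ffun 'I_k -> 'I_n.+1} | mn_support n k x)
     n`!%:R / (\prod_(i < k) (x i : nat)`!%:R) * \prod_(i < k) w i (x i)
  = egf_coef n k w n.
Proof.
rewrite /egf_coef; rewrite (eq_bigr _ (fun i _ => poly_def _ _)).
rewrite bigA_distr_bigA coef_sum mulr_sumr big_mkcond /=; apply: eq_bigr => x _.
rewrite scaler_prod prodrXr coefZ coefXn prodf_div /mn_support eq_sym.
by case: eqP => _; rewrite ?mulr1 ?mulr0 // mulrAC mulrA.
Qed.

Lemma multinomial_theorem (R : realType) (N n k : nat) (P : 'I_k.+1 -> R) : (n <= N)%N ->
  egf_coef N k.+1 (fun i j => P i ^+ j) n = (\sum_i P i) ^+ n.
Proof.
elim: k n P => [|k IHk] n P le_nN; first by rewrite egf_coef1 // big_ord1.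
rewrite egf_coefS // [\sum_i P i]big_ord_recl addrC exprDn; apply: eq_bigr => j _.
by rewrite IHk ?(leq_trans (leq_subr _ _)) // -mulr_natr; ring.
Qed.

Lemma sum_mn_pmf1 (R : realType) (n k : nat) (P : 'I_k -> R) :
  is_distribution k P -> mn_expect n k P (fun=> 1) = 1.
Proof.
move=> [_ sumP].
transitivity (egf_coef n k (fun i j => P i ^+ j) n).
  by rewrite -sum_egf; apply: eq_bigr => x _; rewrite mulr1.
case: k P sumP => [|k] P sumP.
  by move: sumP; rewrite big_ord0 => /esym/eqP; rewrite oner_eq0.
by rewrite multinomial_theorem // sumP expr1n.
Qed.

(* The powers [j ^ s] rather than [(j / n) ^ s] make the bound homogeneous, so
   that the induction on the number of cells needs no normalization of [P]. *)
Lemma egf_coef_tilt_le (R : realType) (N n k : nat) (s : R) (P : 'I_k.+1 -> R) :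
  0 <= s < 1 -> (forall i, 0 <= P i) -> (n <= N)%N ->
  egf_coef N k.+1 (fun i j => (j%:R `^ s * P i `^ (1 - s)) ^+ j) n
  <= (1 - s)^-1 ^+ k * (n%:R `^ s * (\sum_i P i) `^ (1 - s)) ^+ n.
Proof.
move=> s01; elim: k n P => [|k IHk] n P P0 le_nN.
  by rewrite egf_coef1 // big_ord1 mul1r.
have t_ge0 : 0 <= 1 - s by case/andP: s01 => _ /ltW; rewrite subr_ge0.
rewrite egf_coefS // [\sum_i P i]big_ord_recl.
set q := \sum_(i < k.+1) _; have q0 : 0 <= q by apply: sumr_ge0.
(* The induction hypothesis merges all cells but the first into one of mass [q]; the two-cell bound
   then gives the last factor. *)
apply: (@le_trans _ _ ((1 - s)^-1 ^+ k * \sum_(j < n.+1) 'C(n, j)%:R *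
   (j%:R `^ s * P ord0 `^ (1 - s)) ^+ j * ((n - j)%:R `^ s * q `^ (1 - s)) ^+ (n - j))).
  rewrite mulr_sumr; apply: ler_sum => j _.
  rewrite [leRHS]mulrCA ler_wpM2l //.
    by rewrite mulr_ge0 ?exprn_ge0 ?mulr_ge0 ?powR_ge0.
  by apply: IHk => [i|]; rewrite ?(leq_trans (leq_subr _ _)).
by rewrite exprSr -mulrA ler_wpM2l ?binomial_tilt_le ?exprn_ge0 ?invr_ge0.
Qed.

Lemma tilt_factor (R : realType) (n j : nat) (s p : R) : 0 <= s < 1 -> (0 < n)%N -> 0 <= p ->
  let q := j%:R / n%:R in
  p ^+ j * expR (s * n%:R * (if q == 0 then 0 else q * ln (q / p)))
  = (j%:R `^ s * p `^ (1 - s)) ^+ j / (n%:R `^ s) ^+ j.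
Proof.
move=> /andP[s0 s1] n_gt0 p0 q; have N_gt0 : 0 < n%:R :> R by rewrite ltr0n.
rewrite /q mulf_eq0 invr_eq0 (gt_eqF N_gt0) orbF pnatr_eq0.
case: eqP => [->|/eqP jN0]; first by rewrite !expr0 mulr0 expR0 invr1 mulr1.
have j_gt0 : 0 < j%:R :> R by rewrite ltr0n lt0n.
(* At [p = 0] the logarithm has a default value, but a vanishing power multiplies each side since
   [j] is positive. *)
have [->|pN0] := eqVneq p 0.
  by rewrite powR0 ?subr_eq0 ?gt_eqF // mulr0 expr0n (negbTE jN0) !mul0r.
have p_gt0 : 0 < p by rewrite lt0r pN0.
have -> : s * n%:R * (j%:R / n%:R * ln (j%:R / n%:R / p)) =
    j%:R * (s * ln (j%:R / n%:R / p)) by field; rewrite gt_eqF.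
rewrite expRM_natl -exprMn -expr_div_n; congr (_ ^+ _).
rewrite powRB; last by rewrite pN0 implybT.
rewrite powRr1 // /powR !gt_eqF ?divr_gt0 // !ln_div ?posrE ?divr_gt0 //.
by rewrite !mulrBr !expRB; ring.
Qed.

Lemma mgf_V_le (R : realType) (n k : nat) (P : 'I_k.+1 -> R) (s : R) :
  (0 < n)%N -> is_distribution k.+1 P -> 0 <= s < 1 ->
  mn_expect n k.+1 P (fun x => expR (s * n%:R * V_stat n k.+1 P x)) <= (1 - s)^-1 ^+ k.
Proof.
move=> n_gt0 [P0 sumP] s01; have N_gt0 : 0 < n%:R :> R by rewrite ltr0n.
have D_gt0 : 0 < (n%:R `^ s) ^+ n :> R by rewrite exprn_gt0 ?powR_gt0.
have := @egf_coef_tilt_le R n n k s P s01 P0 (leqnn n).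
rewrite sumP powR1 mulr1 -ler_pdivrMr // -sum_egf mulr_suml; apply: le_trans.
rewrite le_eqVlt; apply/orP; left; apply/eqP.
apply: eq_bigr => x /eqP supp_x; rewrite /mn_pmf -[LHS]mulrA -[RHS]mulrA; congr (_ * _).
(* On the support the exponent [n] is the sum of the [x i], so the denominator splits over the
   cells. *)
rewrite -[X in _ ^+ X]supp_x -prodrXr -prodf_div /V_stat /KL mulr_sumr expR_sum.
by rewrite -big_split; apply: eq_bigr => i _; apply: tilt_factor.
Qed.

(** * Elementary inequalities and nonnegativity of the divergence *)

Lemma ln_le_subr1 (R : realType) (x : R) : 0 < x -> ln x <= x - 1.
Proof.
by move=> x_gt0; have := expR_ge1Dx (ln x); rewrite lnK ?posrE // lerBrDl.
Qed.

(** The [2] comes from [expR m >= 1 + m >= 2]; it will cancel the [2] in the definition of the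
    norm. *)
Lemma powR_le_expR (R : realType) (u m : R) : 0 <= u -> 1 <= m -> u `^ m <= m `^ m * (expR u / 2).
Proof.
move=> u0 m1; have m_gt0 : 0 < m by apply: lt_le_trans m1.
have [->|uN0] := eqVneq u 0.
  by rewrite powR0 ?gt_eqF // mulr_ge0 ?powR_ge0 // divr_ge0 ?expR_ge0.
have u_gt0 : 0 < u by rewrite lt0r uN0.
have -> : u `^ m = m `^ m * (u / m) `^ m.
  by rewrite -powRM ?divr_ge0 ?ltW // mulrC divfK ?gt_eqF.
rewrite ler_wpM2l ?powR_ge0 //; apply: (@le_trans _ _ (expR (u - m))).
  rewrite /powR mulf_eq0 invr_eq0 !gt_eqF //= ler_expR.
  have := ln_le_subr1 R (u / m) (divr_gt0 u_gt0 m_gt0).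
  by rewrite -(ler_pM2l m_gt0) mulrBr mulr1 mulrC [m * _]mulrC divfK // gt_eqF.
rewrite expRB ler_wpM2l ?expR_ge0 // lef_pV2 ?posrE ?expR_gt0 //.
by have := expR_ge1Dx m; lra.
Qed.

Lemma bernoulli_inequality (R : realDomainType) (s : R) (k : nat) :
  0 <= s <= 1 -> 1 - k%:R * s <= (1 - s) ^+ k.
Proof.
move=> /andP[s0 s1]; elim: k => [|k IHk]; first by rewrite mul0r subr0.
have t_ge0 : 0 <= 1 - s by rewrite subr_ge0.
rewrite exprS -natr1; apply: le_trans (ler_wpM2l t_ge0 IHk).
have : 0 <= k%:R * s ^+ 2 by rewrite mulr_ge0 ?exprn_ge0.
by nra.
Qed.

Lemma mn_pmf_ge0 (R : realType) (n k : nat) (P : 'I_k -> R) x :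
  (forall i, 0 <= P i) -> 0 <= mn_pmf n k P x.
Proof.
move=> P0; rewrite mulr_ge0 ?divr_ge0 ?prodr_ge0 // => i _.
by rewrite exprn_ge0.
Qed.

(** Each term is at least [q i - p i], and these differences sum to [0]. Absolute continuity
    matters: where [p i = 0], total division makes the term [0] instead of infinite. *)
Lemma KL_ge0 (R : realType) (k : nat) (q p : 'I_k -> R) :
  (forall i, 0 <= q i) -> \sum_i q i = 1 -> is_distribution k p ->
  (forall i, q i != 0 -> p i != 0) -> 0 <= KL k q p.
Proof.
move=> q0 sumq [p0 sump] qp; have <- : \sum_i (q i - p i) = 0.
  by rewrite sumrB sumq sump subrr.
apply: ler_sum => i _; case: eqVneq => [->|qN0]; first by rewrite sub0r oppr_le0.
have q_gt0 : 0 < q i by rewrite lt0r qN0 q0.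
have p_gt0 : 0 < p i by rewrite lt0r qp ?p0.
have -> : ln (q i / p i) = - ln (p i / q i).
  by rewrite -lnV ?posrE ?divr_gt0 // invf_div.
have := ler_wpM2l (ltW q_gt0) (ln_le_subr1 R (p i / q i) (divr_gt0 p_gt0 q_gt0)).
by rewrite mulrBr mulr1 mulrCA divff // mulr1; lra.
Qed.

(** A nonzero likelihood supplies the absolute continuity; on null outcomes the default values could
    make [V_stat] negative. *)
Lemma V_stat_ge0 (R : realType) (n k : nat) (P : 'I_k -> R) x :
  (0 < n)%N -> is_distribution k P -> mn_support n k x -> mn_pmf n k P x != 0 ->
  0 <= V_stat n k P x.
Proof.
move=> n_gt0 dP /eqP supp_x; have N_neq0 : n%:R != 0 :> R by rewrite pnatr_eq0 -lt0n.
rewrite mulf_eq0 negb_or => /andP[_ /prodf_neq0 pmf_x]; apply: KL_ge0 => // [|i].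
- by rewrite -mulr_suml -natr_sum supp_x divff.
- rewrite mulf_eq0 negb_or pnatr_eq0 => /andP[xN0 _].
  by have := pmf_x i isT; rewrite expf_eq0 lt0n xN0.
Qed.

Lemma V_stat1 (R : realType) (n : nat) (P : 'I_1 -> R) x :
  (0 < n)%N -> is_distribution 1 P -> mn_support n 1 x -> V_stat n 1 P x = 0.
Proof.
move=> n_gt0 [_]; rewrite /mn_support /V_stat /KL !big_ord1 => -> /eqP ->.
by rewrite divr1 divff ?pnatr_eq0 -?lt0n // ln1 mulr0 if_same.
Qed.

(** * Subexponential bounds, centering and moments *)

Section Expectation.
Context {R : realType} (n k : nat) (P : 'I_k -> R).
Hypothesis dP : is_distribution k P.
Local Notation E := (mn_expect n k P).
Implicit Types (Y Z : {ffun 'I_k -> 'I_n.+1} -> R) (K : R).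

Lemma mn_expect_le Y Z :
  (forall x, mn_support n k x -> mn_pmf n k P x != 0 -> Y x <= Z x) -> E Y <= E Z.
Proof.
move=> YZ; apply: ler_sum => x supp_x; have [->|pmf_x] := eqVneq (mn_pmf n k P x) 0.
  by rewrite !mul0r.
by rewrite ler_wpM2l ?YZ // mn_pmf_ge0 //; case: dP.
Qed.

Lemma mn_expect_affine (a b : R) Y : E (fun x => a + b * Y x) = a + b * E Y.
Proof.
rewrite -[X in X + _]mulr1 -(sum_mn_pmf1 R n k P dP) /mn_expect !mulr_sumr -big_split.
by apply: eq_bigr => x _ /=; ring.
Qed.

Lemma mn_expectZ (b : R) Y : E (fun x => b * Y x) = b * E Y.
Proof.
by rewrite -[RHS]add0r -mn_expect_affine; apply: eq_bigr => x _; rewrite add0r.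
Qed.

Lemma mn_expect_ge0 Y : (forall x, 0 <= Y x) -> 0 <= E Y.
Proof.
by move=> Y0; apply: sumr_ge0 => x _; rewrite mulr_ge0 // mn_pmf_ge0 //; case: dP.
Qed.

Lemma norm_mn_expect_le Y : `|E Y| <= E (fun x => `|Y x|).
Proof.
apply: le_trans (ler_norm_sum _ _ _) _; apply: ler_sum => x _.
by rewrite normrM ger0_norm // mn_pmf_ge0 //; case: dP.
Qed.

(** Jensen's inequality, from the tangent line of the exponential at the mean. *)
Lemma expR_mn_expect_le Y : expR (E Y) <= E (fun x => expR (Y x)).
Proof.
set mu := E Y; have -> : expR mu = E (fun x => expR mu * (1 - mu) + expR mu * Y x).
  by rewrite mn_expect_affine -/mu; ring.
apply: mn_expect_le => x _ _.
rewrite -[in leRHS](subrK mu (Y x)) expRD [leRHS]mulrC -mulrDr ler_wpM2l ?expR_ge0 //.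
by have := expR_ge1Dx (Y x - mu); lra.
Qed.

Lemma sqr_mn_expect_le Y : (E Y) ^+ 2 <= E (fun x => Y x ^+ 2).
Proof.
set mu := E Y; have -> : mu ^+ 2 = E (fun x => - mu ^+ 2 + (2 * mu) * Y x).
  by rewrite mn_expect_affine -/mu; ring.
by apply: mn_expect_le => x _ _; have := sqr_ge0 (Y x - mu); nra.
Qed.

(* For Y = 0 the infimum defining the norm is not attained, whence the
   quantification over all positive T above K, which also covers K = 0. *)
Definition subexponential K Y : Prop :=
  forall T, 0 < T -> K <= T -> E (fun x => expR (`|Y x| / T)) <= 2.

Lemma psi1_norm_le K Y : 0 <= K -> subexponential K Y -> psi1_norm n k P Y <= K.
Proof.
move=> K0 subY; apply/ler_addgt0Pr => e e0; apply: ge_inf.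
  by exists 0 => t [/ltW].
by split; [rewrite ltr_wpDl | apply: subY; rewrite ?ltr_wpDl // lerDl ltW].
Qed.

(** With [Z = |Y| / T], the exponential moment is at most [expR (E Z) * E (expR Z)], then
    [E (expR Z) ^+ 2], then [E (expR (2 * Z))], which is the hypothesis at [T / 2 >= K]. *)
Lemma subexponential_center K Y :
  subexponential K Y -> subexponential (2 * K) (fun x => Y x - E Y).
Proof.
move=> subY T T_gt0 le_KT; pose Z x := `|Y x| / T.
apply: (@le_trans _ _ (E (fun x => expR (E Z) * expR (Z x)))).
  apply: mn_expect_le => x _ _; rewrite -expRD ler_expR /Z.
  have -> : E (fun x => `|Y x| / T) = T^-1 * E (fun x => `|Y x|).
    by rewrite -mn_expectZ; apply: eq_bigr => y _; rewrite [T^-1 * _]mulrC.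
  rewrite [T^-1 * _]mulrC -mulrDl ler_pM2r ?invr_gt0 // [leRHS]addrC.
  by rewrite (le_trans (ler_normB _ _)) // lerD2l norm_mn_expect_le.
rewrite mn_expectZ; apply: (@le_trans _ _ (E (fun x => expR (Z x)) ^+ 2)).
  by rewrite expr2 ler_wpM2r ?expR_mn_expect_le // mn_expect_ge0 // => x; exact: expR_ge0.
apply: le_trans (sqr_mn_expect_le _) _.
have -> : E (fun x => expR (Z x) ^+ 2) = E (fun x => expR (`|Y x| / (T / 2))).
  apply: eq_bigr => x _; rewrite -expRM_natl /Z; congr (_ * expR _).
  by field; rewrite gt_eqF.
by apply: subY; lra.
Qed.

Lemma subexponential_moment K Y (m : R) : 0 <= K -> 1 <= m -> subexponential K Y ->
  E (fun x => `|Y x| `^ m) <= (m * K) `^ m.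
Proof.
move=> K0 m1 subY; have m_gt0 : 0 < m by apply: lt_le_trans m1.
have bound T : 0 < T -> K <= T -> E (fun x => `|Y x| `^ m) <= (m * T) `^ m.
  move=> T_gt0 le_KT.
  apply: (@le_trans _ _ (E (fun x => ((m * T) `^ m / 2) * expR (`|Y x| / T)))).
    apply: mn_expect_le => x _ _.
    have -> : `|Y x| `^ m = (`|Y x| / T) `^ m * T `^ m.
      by rewrite -powRM ?divr_ge0 ?(ltW T_gt0) // divfK ?gt_eqF.
    rewrite powRM ?(ltW m_gt0) ?(ltW T_gt0) //.
    rewrite [leRHS](_ : _ = m `^ m * (expR (`|Y x| / T) / 2) * T `^ m); last by ring.
    by rewrite ler_wpM2r ?powR_ge0 // powR_le_expR // ?divr_ge0 // ltW.
  rewrite mn_expectZ; apply: le_trans (ler_wpM2l _ (subY T T_gt0 le_KT)) _.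
    by rewrite divr_ge0 ?powR_ge0.
  by rewrite divfK.
have [K_eq0|KN0] := eqVneq K 0; last by apply: bound; rewrite // lt0r KN0.
rewrite K_eq0 mulr0 powR0 ?gt_eqF //; apply/ler_addgt0Pr => e e_gt0; rewrite add0r.
(* This [T] is chosen so that [m * T], raised to the power [m], equals [e]. *)
apply: le_trans (bound (e `^ m^-1 / m) _ _) _.
- by rewrite divr_gt0 ?powR_gt0.
- by rewrite K_eq0 divr_ge0 ?powR_ge0 ?ltW.
- by rewrite mulrC divfK ?gt_eqF // -powRrM mulVf ?gt_eqF // powRr1 // ltW.
Qed.

End Expectation.

(** * The subexponential bound for [V_stat] and its consequences *)

Lemma subexponential_V (R : realType) (n k : nat) (P : 'I_k -> R) :
  (0 < n)%N -> is_distribution k P ->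
  subexponential n k P (4 * k.-1%:R) (fun x => 2 * n%:R * V_stat n k P x).
Proof.
move=> n_gt0 dP T T_gt0 le_KT.
case: k P dP le_KT => [|[|k]] P dP le_KT.
- by case: dP => _; rewrite big_ord0 => /esym/eqP; rewrite oner_eq0.
(* For one cell [T] may be arbitrarily small, so that [2 / T] leaves the range of [mgf_V_le]; but
   [V_stat] vanishes. *)
- apply: (@le_trans _ _ (mn_expect n 1 P (fun=> 1))).
    apply: mn_expect_le => // x supp_x _.
    by rewrite V_stat1 // mulr0 normr0 mul0r expR0.
  by rewrite sum_mn_pmf1 // ler1n.
(* Then [s * n * V] is [2 * n * V / T], and [T >= 4 * k.+1] gives [k.+1 * s <= 1 / 2]; here [k.+1]
   is the number of cells minus one. *)
pose s := 2 / T.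
have s0 : 0 <= s by rewrite divr_ge0 // ltW.
have ks : k.+1%:R * s <= 2^-1.
  by rewrite /s mulrA ler_pdivrMr //; move: le_KT => /=; lra.
have s1 : s <= 2^-1.
  by apply: le_trans ks; rewrite ler_peMl // ler1n.
have t_gt0 : 0 < 1 - s by lra.
apply: (@le_trans _ _ ((1 - s)^-1 ^+ k.+1)); last first.
  rewrite exprVn -[leRHS]invrK lef_pV2 ?posrE ?invr_gt0 ?exprn_gt0 //.
  by apply: le_trans (bernoulli_inequality _ _ _ _); lra.
have s01 : 0 <= s < 1 by lra.
apply: le_trans (mgf_V_le R n k.+1 P s n_gt0 dP s01).
apply: mn_expect_le => // x supp_x pmf_x.
rewrite ger0_norm; last by rewrite !mulr_ge0 // V_stat_ge0.
by rewrite le_eqVlt /s; apply/orP; left; apply/eqP; congr expR; ring.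
Qed.

(** The centered variable takes both signs, so its real powers are taken of the absolute value,
    which also dominates signed integer moments. *)
Theorem theorem3p2 (R : realType) :
  (forall (n k : nat) (P : 'I_k -> R), (0 < n)%N -> (0 < k)%N -> is_distribution k P ->
     psi1_norm n k P (fun x => 2 * n%:R * V_stat n k P x) <= 4 * (k.-1)%:R /\
     psi1_norm n k P (fun x => 2 * n%:R * V_stat n k P x
                       - mn_expect n k P (fun y => 2 * n%:R * V_stat n k P y))
       <= 8 * (k.-1)%:R) /\
  (exists C1 C2 : R, 0 < C1 /\ 0 < C2 /\
     forall (n k : nat) (P : 'I_k -> R) (m : R),
       (0 < n)%N -> (0 < k)%N -> is_distribution k P -> 1 <= m ->
       mn_expect n k P (fun x => (2 * n%:R * V_stat n k P x) `^ m)
         <= (C1 * m * (k.-1)%:R) `^ m /\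
       mn_expect n k P (fun x => `|2 * n%:R * V_stat n k P x
                          - mn_expect n k P (fun y => 2 * n%:R * V_stat n k P y)| `^ m)
         <= (C2 * m * (k.-1)%:R) `^ m).
Proof.
have K4 (k : nat) : 0 <= 4 * k.-1%:R :> R by rewrite mulr_ge0.
have K8 (k : nat) : 8 * k.-1%:R = 2 * (4 * k.-1%:R) :> R by ring.
split=> [n k P n_gt0 _ dP|].
  have subV := subexponential_V R n k P n_gt0 dP.
  split; first exact: psi1_norm_le.
  by rewrite K8; apply: psi1_norm_le; [rewrite mulr_ge0 | exact: subexponential_center].
exists 4, 8; do 2!split=> //; move=> n k P m n_gt0 _ dP m1.
have subV := subexponential_V R n k P n_gt0 dP; split.
  rewrite (mulrC 4) -mulrA; apply: le_trans (subexponential_moment n k P dP _ _ _ _ m1 subV) => //.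
  apply: mn_expect_le => // x supp_x pmf_x.
  by rewrite ger0_norm ?lexx // !mulr_ge0 ?V_stat_ge0.
rewrite (mulrC 8) -mulrA K8; apply: subexponential_moment => //.
exact: subexponential_center.
Qed.
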